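(* The following two rules are admissible in $\mathrm{G3S5}^{;}$, where all formulas in the middle parts of the premises (in particular the formula $D$ in the second rule) are atomic. (Cut) For every formula $D$, all multisets of formulas $\Gamma,\Gamma',\Delta,\Delta'$ and all multisets of atomic formulas $P,P',Q,Q'$: $$\dfrac{\Gamma;P\vdash Q;\Delta,D\qquad D,\Gamma';P'\vdash Q';\Delta'}{\Gamma,\Gamma';P,P'\vdash Q,Q';\Delta,\Delta'}$$ ($\mathrm{Cut}^{;}$) For every atomic formula $D$, all multisets of modal formulas $M,M',N,N'$, all multisets of arbitrary formulas $\Gamma_1,\Gamma_1',\Delta_1,\Delta_1'$, and all multisets of atomic formulas $P_2,P_3,Q_2,Q_3,P_2',P_3',Q_2',Q_3'$: $$\dfrac{M,\Gamma_1;P_2,P_3\vdash Q_3,Q_2,D;\Delta_1,N\qquad M',\Gamma_1';D,P_2',P_3'\vdash Q_3',Q_2';\Delta_1',N'}{M,M',P_2,P_2';\Gamma_1,\Gamma_1',P_3,P_3'\vdash Q_3,Q_3',\Delta_1,\Delta_1';Q_2,Q_2',N,N'}$$ Here, in the left premise, $P_2$ together with $Q_2,D$ forms one block, so that $\Diamond\bigwedge(P_2,\neg Q_2,\neg D)$ is in the antecedent or $\Box\bigvee(\neg P_2,D,Q_2)$ is in the succedent; and in the right premise $D,P_2'$ together with $Q_2'$ forms one block, so that $\Diamond\bigwedge(D,P_2',\neg Q_2')$ is in the antecedent or $\Box\bigvee(\neg D,\neg P_2',Q_2')$ is in the succedent.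
   Context: Formulas: $A::=\bot\mid\top\mid p\mid\neg A\mid A\wedge A\mid A\vee A\mid A\to A\mid\Diamond A\mid\Box A$ ($p$ a propositional variable); $\top$ is read as an abbreviation of $\neg\bot$. Atomic formulas are the variables and $\bot$; modal formulas are those of the form $\Diamond A$ or $\Box A$. Multisets are finite; a comma denotes multiset union; $\neg\Gamma=\{\neg A:A\in\Gamma\}$. $\bigwedge X$, $\bigvee X$ are the conjunction and disjunction of the members of the multiset $X$ (in a fixed order; just the member if $X$ is a singleton). Semicolon sequents. A sequent $\Gamma;P\vdash Q;\Delta$ consists of multisets of formulas $\Gamma,\Delta$, multisets $P,Q$ of atomic formulas (the middle part), and a partition of the occurrences in $P$ and $Q$ into nonempty blocks, each marked as a $\Diamond$-block or a $\Box$-block. A block consisting of $P_0$ from $P$ and $Q_0$ from $Q$ has corresponding formula $\Diamond\bigwedge(P_0,\neg Q_0)$ if it is a $\Diamond$-block and $\Box\bigvee(\neg P_0,Q_0)$ if it is a $\Box$-block. The sequent stands for the ordinary sequent obtained by adding the corresponding formulas of all $\Diamond$-blocks to the antecedent $\Gamma$ and those of all $\Box$-blocks to the succedent $\Delta$. Semicolons next to an empty middle part are omitted; ordinary sequents $\Gamma\vdash\Delta$ have empty middle part. If a block contains a non-atomic formula, the notation abbreviates the sequent in which that block is deleted from the middle part and its corresponding formula is placed in the outer antecedent ($\Diamond$) or outer succedent ($\Box$). The system $\mathrm{G3S5}^{;}$ ($M,N$ multisets of modal formulas; $P,Q,P_i,Q_i$ multisets of atomic formulas; $\Gamma,\Delta$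 arbitrary; premises before $\Rightarrow$, conclusion after). Axioms: $p,\Gamma;P\vdash Q;\Delta,p$ ($p$ atomic) and $\bot,\Gamma;P\vdash Q;\Delta$. L$\neg$: $\Gamma;P\vdash Q;\Delta,A\ \Rightarrow\ \neg A,\Gamma;P\vdash Q;\Delta$. R$\neg$: $A,\Gamma;P\vdash Q;\Delta\ \Rightarrow\ \Gamma;P\vdash Q;\Delta,\neg A$. L$\vee$: $A,\Gamma;P\vdash Q;\Delta$ and $B,\Gamma;P\vdash Q;\Delta\ \Rightarrow\ A\vee B,\Gamma;P\vdash Q;\Delta$. R$\vee$: $\Gamma;P\vdash Q;\Delta,A,B\ \Rightarrow\ \Gamma;P\vdash Q;\Delta,A\vee B$. L$\wedge$: $A,B,\Gamma;P\vdash Q;\Delta\ \Rightarrow\ A\wedge B,\Gamma;P\vdash Q;\Delta$. R$\wedge$: $\Gamma;P\vdash Q;\Delta,A$ and $\Gamma;P\vdash Q;\Delta,B\ \Rightarrow\ \Gamma;P\vdash Q;\Delta,A\wedge B$. L$\to$: $\Gamma;P\vdash Q;\Delta,A$ and $B,\Gamma;P\vdash Q;\Delta\ \Rightarrow\ A\to B,\Gamma;P\vdash Q;\Delta$. R$\to$: $A,\Gamma;P\vdash Q;\Delta,B\ \Rightarrow\ \Gamma;P\vdash Q;\Delta,A\to B$. R$\Diamond$: $\Gamma;P\vdash Q;\Delta,\Diamond A,A\ \Rightarrow\ \Gamma;P\vdash Q;\Delta,\Diamond A$. L$\Box$: $A,\Box A,\Gamma;P\vdash Q;\Delta\ \Rightarrow\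 \Box A,\Gamma;P\vdash Q;\Delta$. L$\Diamond$: $A,M;P_1,P_2\vdash Q_2,Q_1;N\ \Rightarrow\ \Diamond A,M,P_1;P_2\vdash Q_2;Q_1,N$. R$\Box$: $M;P_1,P_2\vdash Q_2,Q_1;N,A\ \Rightarrow\ M,P_1;P_2\vdash Q_2;Q_1,N,\Box A$. L$\Diamond^{;}$ and R$\Box^{;}$ (same shape): $M,P_2;P_1,P_3\vdash Q_3,Q_1;Q_2,N\ \Rightarrow\ M,P_1;P_2,P_3\vdash Q_3,Q_2;Q_1,N$. In the rules other than L$\Diamond$, R$\Box$, L$\Diamond^{;}$, R$\Box^{;}$ the marked partition is the same in premises and conclusion. In L$\Diamond$ (resp. R$\Box$) the premise has the blocks of the conclusion together with the new block formed by $P_1,Q_1$, marked $\Box$ (resp. $\Diamond$); no block is added if $P_1,Q_1$ are both empty. In L$\Diamond^{;}$ (resp. R$\Box^{;}$) $P_2,Q_2$ form one $\Diamond$-block (resp. $\Box$-block) of the conclusion; in the premise this block is removed, $P_1,Q_1$ form a new $\Box$-block (resp. $\Diamond$-block; none if empty), and the blocks of $P_3,Q_3$ are unchanged. A rule is admissible if, for each of its instances, provability of all premises in $\mathrm{G3S5}^{;}$ implies provability of the conclusion. In Cut the blocks of the conclusion are those of both premises. In $\mathrm{Cut}^{;}$ the blocks of the conclusion are those of $P_3,Q_3$ in the left premise and of $P_3',Q_3'$ in the right premise, unchanged, together with a block formed by $\Gamma_1,\Delta_1$ and a block formed by $\Gamma_1',\Delta_1'$ (each with corresponding formula $\Diamond\bigwedge(\Gamma_1,\neg\Delta_1)$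 in the antecedent or $\Box\bigvee(\neg\Gamma_1,\Delta_1)$ in the succedent, and similarly with primes; no block if empty). *)

(* Defs.v *)
From HB Require Import structures.
From mathcomp Require Import all_boot.
From mathcomp Require Import finmap multiset.

Set Implicit Arguments.
Unset Strict Implicit.
Unset Printing Implicit Defensive.

Open Scope mset_scope.

(* [Var n] is the n-th propositional variable. *)
Inductive form : Type :=
  | Bot
  | Var of nat
  | Neg of form
  | And of form & form
  | Or of form & form
  | Imp of form & form
  | Dia of form
  | Box of form.

Definition Top : form := Neg Bot.

(* Multisets need a choiceType of elements; formulas are countable because
   they embed into the generic trees of choice.v. *)
Fixpoint form_encode (A : form) : GenTree.tree nat :=
  match A with
  | Bot => GenTree.Node 0 [::]
  | Var n => GenTree.Leaf n
  | Neg A => GenTree.Node 1 [:: form_encode A]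
  | And A B => GenTree.Node 2 [:: form_encode A; form_encode B]
  | Or A B => GenTree.Node 3 [:: form_encode A; form_encode B]
  | Imp A B => GenTree.Node 4 [:: form_encode A; form_encode B]
  | Dia A => GenTree.Node 5 [:: form_encode A]
  | Box A => GenTree.Node 6 [:: form_encode A]
  end.

Fixpoint form_decode (t : GenTree.tree nat) : form :=
  match t with
  | GenTree.Leaf n => Var n
  | GenTree.Node 1 [:: t] => Neg (form_decode t)
  | GenTree.Node 2 [:: t; u] => And (form_decode t) (form_decode u)
  | GenTree.Node 3 [:: t; u] => Or (form_decode t) (form_decode u)
  | GenTree.Node 4 [:: t; u] => Imp (form_decode t) (form_decode u)
  | GenTree.Node 5 [:: t] => Dia (form_decode t)
  | GenTree.Node 6 [:: t] => Box (form_decode t)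
  | _ => Bot
  end.

Lemma form_encodeK : cancel form_encode form_decode.
Proof. by elim=> //= [A -> | A -> B -> | A -> B -> | A -> B -> | A -> | A ->]. Qed.

HB.instance Definition _ := Countable.copy form (can_type form_encodeK).

Definition atomic (A : form) : bool :=
  match A with Bot | Var _ => true | _ => false end.

Definition modal (A : form) : bool :=
  match A with Dia _ | Box _ => true | _ => false end.

Definition all_atomic (X : {mset form}) : bool := all atomic X.
Definition all_modal (X : {mset form}) : bool := all modal X.

Definition msetNeg (X : {mset form}) : {mset form} :=
  seq_mset [seq Neg A | A <- X].

(* The value on the empty sequence is never used, since blocks are nonempty. *)
Fixpoint conj_seq (s : seq form) : form :=
  match s with
  | [::] => Top
  | [:: A] => A
  | A :: s' => And A (conj_seq s')
  end.

Fixpoint disj_seq (s : seq form) : form :=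
  match s with
  | [::] => Bot
  | [:: A] => A
  | A :: s' => Or A (disj_seq s')
  end.

(* The fixed order on the members of a multiset is that of [enum_mset]. *)
Definition bigand (X : {mset form}) : form := conj_seq (enum_mset X).
Definition bigor (X : {mset form}) : form := disj_seq (enum_mset X).

Variant mark : Type := DiaMark | BoxMark.

Definition mark_to_bool (k : mark) : bool := if k is BoxMark then true else false.
Definition mark_of_bool (b : bool) : mark := if b then BoxMark else DiaMark.

Lemma mark_to_boolK : cancel mark_to_bool mark_of_bool.
Proof. by case. Qed.

HB.instance Definition _ := Countable.copy mark (can_type mark_to_boolK).

(* [(k, P, Q)]: P is the part of the block on the left of the turnstile,
   Q its part on the right. *)
Definition block : Type := (mark * {mset form} * {mset form})%type.

Definition empty_block (P Q : {mset form}) : bool :=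
  (P == mset0) && (Q == mset0).

Definition block_ok (b : block) : bool :=
  let: (_, P, Q) := b in
  [&& all_atomic P, all_atomic Q & ~~ empty_block P Q].

(* A middle part P |- Q together with its marked partition is represented by
   the multiset of its blocks; P and Q are the sums of the two components. *)
Notation middle := {mset block}.

Definition middle_ok (U : middle) : bool := all block_ok (enum_mset U).

(* [G ;; U |-- D] is the semicolon sequent with antecedent G, succedent D and
   blocks U.  It is a genuine sequent when [middle_ok U]; this holds
   for every provable sequent, as the axioms of [provable] require it and the
   rules preserve it. *)
Definition sequent : Type := ({mset form} * middle * {mset form})%type.

Notation "G ;; U |-- D" := ((G, U, D) : sequent)
  (at level 70, U at next level, D at next level,
   format "G  ;;  U  |--  D").

Definition block_form (k : mark) (P Q : {mset form}) : form :=
  match k with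
  | DiaMark => Dia (bigand (P `+` msetNeg Q))
  | BoxMark => Box (bigor (msetNeg P `+` Q))
  end.

(* Adds to a sequent the block formed by P and Q: nothing if it is empty, and
   its corresponding formula if it contains a non-atomic formula. *)
Definition add_block (k : mark) (P Q : {mset form}) (s : sequent) : sequent :=
  let: (G, U, D) := s in
  if empty_block P Q then s
  else if all_atomic P && all_atomic Q then G ;; (k, P, Q) +` U |-- D
  else match k with
       | DiaMark => block_form k P Q +` G ;; U |-- D
       | BoxMark => G ;; U |-- D `+` [mset block_form k P Q]
       end.

Implicit Types (p A B : form) (G D M N P Q : {mset form}) (U : middle).

Inductive provable : sequent -> Prop :=
  | Ax p G U D : atomic p -> middle_ok U ->
      provable (p +` G ;; U |-- D `+` [mset p])
  | LBot G U D : middle_ok U ->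
      provable (Bot +` G ;; U |-- D)
  | LNeg A G U D :
      provable (G ;; U |-- D `+` [mset A]) ->
      provable (Neg A +` G ;; U |-- D)
  | RNeg A G U D :
      provable (A +` G ;; U |-- D) ->
      provable (G ;; U |-- D `+` [mset Neg A])
  | LOr A B G U D :
      provable (A +` G ;; U |-- D) ->
      provable (B +` G ;; U |-- D) ->
      provable (Or A B +` G ;; U |-- D)
  | ROr A B G U D :
      provable (G ;; U |-- D `+` [mset A; B]) ->
      provable (G ;; U |-- D `+` [mset Or A B])
  | LAnd A B G U D :
      provable ([mset A; B] `+` G ;; U |-- D) ->
      provable (And A B +` G ;; U |-- D)
  | RAnd A B G U D :
      provable (G ;; U |-- D `+` [mset A]) ->
      provable (G ;; U |-- D `+` [mset B]) ->
      provable (G ;; U |-- D `+` [mset And A B])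
  | LImp A B G U D :
      provable (G ;; U |-- D `+` [mset A]) ->
      provable (B +` G ;; U |-- D) ->
      provable (Imp A B +` G ;; U |-- D)
  | RImp A B G U D :
      provable (A +` G ;; U |-- D `+` [mset B]) ->
      provable (G ;; U |-- D `+` [mset Imp A B])
  | RDia A G U D :
      provable (G ;; U |-- D `+` [mset Dia A; A]) ->
      provable (G ;; U |-- D `+` [mset Dia A])
  | LBox A G U D :
      provable ([mset A; Box A] `+` G ;; U |-- D) ->
      provable (Box A +` G ;; U |-- D)
  | LDia A M N P1 Q1 U :
      all_modal M -> all_modal N -> all_atomic P1 -> all_atomic Q1 ->
      provable (add_block BoxMark P1 Q1 (A +` M ;; U |-- N)) ->
      provable (Dia A +` M `+` P1 ;; U |-- Q1 `+` N)
  | RBox A M N P1 Q1 U :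
      all_modal M -> all_modal N -> all_atomic P1 -> all_atomic Q1 ->
      provable (add_block DiaMark P1 Q1 (M ;; U |-- N `+` [mset A])) ->
      provable (M `+` P1 ;; U |-- Q1 `+` N `+` [mset Box A])
  | LDiaSemi M N P1 Q1 P2 Q2 U :
      all_modal M -> all_modal N -> all_atomic P1 -> all_atomic Q1 ->
      block_ok (DiaMark, P2, Q2) ->
      provable (add_block BoxMark P1 Q1 (M `+` P2 ;; U |-- Q2 `+` N)) ->
      provable (M `+` P1 ;; (DiaMark, P2, Q2) +` U |-- Q1 `+` N)
  | RBoxSemi M N P1 Q1 P2 Q2 U :
      all_modal M -> all_modal N -> all_atomic P1 -> all_atomic Q1 ->
      block_ok (BoxMark, P2, Q2) ->
      provable (add_block DiaMark P1 Q1 (M `+` P2 ;; U |-- Q2 `+` N)) ->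
      provable (M `+` P1 ;; (BoxMark, P2, Q2) +` U |-- Q1 `+` N).

(* A rule is the relation between the premises and the conclusion of its
   instances. *)
Definition rule : Type := seq sequent -> sequent -> Prop.

Definition admissible (R : rule) : Prop :=
  forall (premises : seq sequent) (conclusion : sequent),
    R premises conclusion ->
    (forall s, s \in premises -> provable s) ->
    provable conclusion.

Variant Cut : rule :=
  | Cut_instance (D : form) (G G' De De' : {mset form}) (U U' : middle) :
      middle_ok U -> middle_ok U' ->
      Cut [:: G ;; U |-- De `+` [mset D];
              D +` G' ;; U' |-- De']
          (G `+` G' ;; U `+` U' |-- De `+` De').

(* U3 and U3' are the blocks of P3, Q3 and of P3', Q3'.  The marks k, k' of the
   two blocks with the cut formula and the marks l, l' of the two new blocks
   are arbitrary. *)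
Variant CutSemi : rule :=
  | CutSemi_instance (D : form) (M M' N N' G1 G1' D1 D1' : {mset form})
      (P2 Q2 P2' Q2' : {mset form}) (U3 U3' : middle) (k k' l l' : mark) :
      atomic D ->
      all_modal M -> all_modal M' -> all_modal N -> all_modal N' ->
      all_atomic P2 -> all_atomic Q2 -> all_atomic P2' -> all_atomic Q2' ->
      middle_ok U3 -> middle_ok U3' ->
      CutSemi
        [:: M `+` G1 ;; (k, P2, Q2 `+` [mset D]) +` U3 |-- D1 `+` N;
            M' `+` G1' ;; (k', D +` P2', Q2') +` U3' |-- D1' `+` N']
        (add_block l G1 D1 (add_block l' G1' D1'
           (M `+` M' `+` P2 `+` P2' ;; U3 `+` U3' |-- Q2 `+` Q2' `+` N `+` N'))).

(* Main.v *)
Require Import Defs.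
From mathcomp Require Import all_boot.
From mathcomp Require Import finmap multiset.
From mathcomp Require Import zify.
From Stdlib Require Import Classical Setoid.

(* Cut is eliminated semantically, through Kripke models with the universal
   accessibility relation.  A sequent is refuted at a world w when its ordinary
   part fails at w and each block P |- Q is realised (P true, Q false) at some
   world; the marks of the blocks play no role.  Under this reading both cut
   rules are sound, so they are admissible as soon as the calculus is complete.

   For completeness, start from an unprovable sequent and search backwards.  The
   propositional rules are applied until the current component contains only
   atoms and modal formulas.  Then either an unwitnessed <>A of the antecedent
   (or []A of the succedent) opens a new world, the current one being stored as
   a block, or one moves to a world at which the body of some []A of the
   antecedent (or <>A of the succedent) is not yet forced and instantiates it
   there.  A memory H keeps the modal formulas that have been consumed, so that
   no formula is witnessed twice; all formulas are subformulas of the initial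
   ones, whence the search terminates.  The worlds of the final unprovable
   sequent form a countermodel. *)

Set Implicit Arguments.
Unset Strict Implicit.
Unset Printing Implicit Defensive.

Open Scope mset_scope.

(** * Soundness *)

Lemma seq_mset_cat (K : choiceType) (s t : seq K) :
  seq_mset (s ++ t) = seq_mset s `+` seq_mset t.
Proof. by apply/msetP => x; rewrite msetE2 !mset_seqE count_cat. Qed.

Lemma seq_mset_nil (K : choiceType) : seq_mset [::] = mset0 :> {mset K}.
Proof. by apply/msetP => x; rewrite mset_seqE mset0E. Qed.

Lemma mem_seq_mset (K : choiceType) (s : seq K) : seq_mset s =i s.
Proof. exact: perm_mem (perm_eq_seq_mset s). Qed.

Lemma all_seq_mset (K : choiceType) (a : pred K) (s : seq K) :
  all a (seq_mset s) = all a s.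
Proof. exact: perm_all (perm_eq_seq_mset s). Qed.

Section Semantics.

Variables (W : Type) (V : W -> nat -> Prop).
Implicit Types (w x : W) (A : form) (G D P Q X : {mset form}) (s : sequent).

Fixpoint holds w A : Prop :=
  match A with
  | Bot => False
  | Var n => V w n
  | Neg A => ~ holds w A
  | And A B => holds w A /\ holds w B
  | Or A B => holds w A \/ holds w B
  | Imp A B => holds w A -> holds w B
  | Dia A => exists x, holds x A
  | Box A => forall x, holds x A
  end.

Definition all_true w G := forall A, A \in G -> holds w A.
Definition all_false w D := forall A, A \in D -> ~ holds w A.

Definition realised w P Q := all_true w P /\ all_false w Q.

(** A true [<>]-formula in the antecedent and a false [[]]-formula in the succedent both amount to a
    world realising the block, so one clause serves both marks. *)
Definition refutes w s : Prop :=
  let: (G, U, D) := s in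
  realised w G D /\ forall b : block, b \in U -> exists x, realised x b.1.2 b.2.

Lemma all_trueD w G D : all_true w (G `+` D) <-> all_true w G /\ all_true w D.
Proof.
split=> [h | [hG hD] A]; last by rewrite in_msetD => /orP[/hG | /hD].
by split=> A hA; apply: h; rewrite in_msetD hA ?orbT.
Qed.

Lemma all_falseD w G D :
  all_false w (G `+` D) <-> all_false w G /\ all_false w D.
Proof.
split=> [h | [hG hD] A]; last by rewrite in_msetD => /orP[/hG | /hD].
by split=> A hA; apply: h; rewrite in_msetD hA ?orbT.
Qed.

Lemma all_true1 w A : all_true w [mset A] <-> holds w A.
Proof. by split=> [h | h B /mset1P-> //]; apply: h; rewrite mset11. Qed.

Lemma all_false1 w A : all_false w [mset A] <-> ~ holds w A.
Proof. by split=> [h | h B /mset1P-> //]; apply: h; rewrite mset11. Qed.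

Lemma refutes_cons w b G U D :
  refutes w (G, b +` U, D) <->
  refutes w (G, U, D) /\ exists x, realised x b.1.2 b.2.
Proof.
split=> [[h hU] | [[h hU] hb]].
  split; last by apply: hU; apply: mset1D1.
  by split=> // c hc; apply: hU; apply: mset1Dr.
by split=> // c; rewrite in_mset1D => /predU1P[-> | /hU].
Qed.

(** Accessibility is universal, so the truth of a modal formula does not depend on the world. This
    carries the contexts M and N from one world to another. *)
Lemma holds_modal w x A : modal A -> holds w A -> holds x A.
Proof. by case: A. Qed.

Lemma all_true_modal w x G : all_modal G -> all_true w G -> all_true x G.
Proof. by move=> /allP mG h A hA; apply: holds_modal (mG _ hA) (h _ hA). Qed.

Lemma all_false_modal w x G : all_modal G -> all_false w G -> all_false x G.
Proof.
by move=> /allP mG h A hA hx; apply: (h _ hA); apply: holds_modal (mG _ hA) hx.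
Qed.

Lemma holds_bigand w X : holds w (bigand X) <-> all_true w X.
Proof.
rewrite /bigand; change (all_true w X) with (forall A, A \in enum_mset X -> holds w A).
elim: (enum_mset X) => [|A [|B r] IH]; first by split=> // _ [].
  by split=> [h C /[!inE]/eqP-> // | ]; apply; rewrite inE.
split=> [[hA /IH hr] C /[1!inE] /predU1P[-> | /hr] // | h].
split; first by apply: h; apply: mem_head.
by apply/IH => C hC; apply: h; rewrite inE hC orbT.
Qed.

Lemma holds_bigor w X A : A \in X -> holds w A -> holds w (bigor X).
Proof.
rewrite /bigor; change (A \in X) with (A \in enum_mset X : bool).
elim: (enum_mset X) => //= B [|C r] IH.
  by rewrite inE => /eqP->.
by rewrite inE => /predU1P[-> | /IH{}IH hA]; [left | right; apply: IH].
Qed.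

Lemma in_msetNeg A X : A \in X -> Neg A \in msetNeg X.
Proof. by move=> hA; rewrite /msetNeg mem_seq_mset map_f. Qed.

Lemma block_form_Dia w P Q :
  holds w (block_form DiaMark P Q) -> exists x, realised x P Q.
Proof.
case=> x /holds_bigand/all_trueD[hP hQ]; exists x; split=> // A hA.
exact: hQ (in_msetNeg hA).
Qed.

Lemma block_form_Box w P Q :
  ~ holds w (block_form BoxMark P Q) -> exists x, realised x P Q.
Proof.
move=> /not_all_ex_not[x hx]; exists x; split=> A hA; last first.
  by move=> h; apply: hx; apply: holds_bigor h; rewrite in_msetD hA orbT.
apply: NNPP => h; apply: hx; apply: (@holds_bigor _ _ (Neg A)) => //.
by rewrite in_msetD in_msetNeg.
Qed.

(** Without atomicity the block may have become an outer formula; its truth value then still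
    provides a realising world. This is what [CutSemi] needs for its new blocks. *)
Lemma refutes_add_block_inv w k P Q s :
  refutes w (add_block k P Q s) -> refutes w s /\ exists x, realised x P Q.
Proof.
case: s => [[G U] D] /=; case: ifP => [/andP[/eqP-> /eqP->] | _].
  (* Any world realises the empty block; [w] is at hand. *)
  by split=> //; exists w; split=> A; rewrite in_mset0.
case: ifP => [_ /refutes_cons // | _]; case: k => -[[]].
- case/all_trueD => /all_true1/block_form_Dia hb hG hD hU.
  by split=> //; split.
- move=> hG /all_falseD[hD /all_false1/block_form_Box hb] hU.
  by split=> //; split.
Qed.

Lemma refutes_add_block w k P Q s : all_atomic P -> all_atomic Q ->
  refutes w s -> (exists x, realised x P Q) -> refutes w (add_block k P Q s).
Proof.
move=> aP aQ; case: s => [[G U] D] hs hb /=; case: ifP => // _.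
by rewrite aP aQ; apply/refutes_cons.
Qed.

(* Every rule can be read from conclusion to premises: a countermodel of the
   conclusion is one of a premise, possibly at another world. *)
Lemma soundness s : provable s -> forall w, ~ refutes w s.
Proof.
elim=> {s}.
- by move=> p G U D _ _ w [[/all_trueD[/all_true1 h _] /all_falseD[_ /all_false1]]].
- by move=> G U D _ w [[/all_trueD[/all_true1]]].
- move=> A G U D _ IH w [[/all_trueD[/all_true1 /= h hG] hD] hU].
  by apply: (IH w); do !split=> //; apply/all_falseD; rewrite all_false1.
- move=> A G U D _ IH w [[hG /all_falseD[hD /all_false1/NNPP h]] hU].
  by apply: (IH w); do !split=> //; apply/all_trueD; rewrite all_true1.
- move=> A B G U D _ IHA _ IHB w [[/all_trueD[/all_true1[] h hG] hD] hU].
    by apply: (IHA w); do !split=> //; apply/all_trueD; rewrite all_true1.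
  by apply: (IHB w); do !split=> //; apply/all_trueD; rewrite all_true1.
- move=> A B G U D _ IH w [[hG /all_falseD[hD /all_false1/not_or_and[hA hB]]] hU].
  by apply: (IH w); do !split=> //; rewrite !(all_falseD, all_false1).
- move=> A B G U D _ IH w [[/all_trueD[/all_true1[hA hB] hG] hD] hU].
  by apply: (IH w); do !split=> //; rewrite !(all_trueD, all_true1).
- move=> A B G U D _ IHA _ IHB w [[hG /all_falseD[hD /all_false1/not_and_or[h|h]]] hU].
    by apply: (IHA w); do !split=> //; rewrite !(all_falseD, all_false1).
  by apply: (IHB w); do !split=> //; rewrite !(all_falseD, all_false1).
- move=> A B G U D _ IHA _ IHB w [[/all_trueD[/all_true1/= hAB hG] hD] hU].
  have [hA|hA] := classic (holds w A).
    apply: (IHB w); do !split=> //; rewrite all_trueD all_true1.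
    by split=> //; apply: hAB.
  by apply: (IHA w); do !split=> //; rewrite !(all_falseD, all_false1).
- move=> A B G U D _ IH w [[hG /all_falseD[hD /all_false1/= h]] hU].
  have [hA hB] := imply_to_and _ _ h.
  by apply: (IH w); do !split=> //; rewrite !(all_trueD, all_true1, all_falseD, all_false1).
- move=> A G U D _ IH w [[hG /all_falseD[hD /all_false1/= h]] hU].
  apply: (IH w); do !split=> //; rewrite !(all_falseD, all_false1); do !split=> //.
  by move=> hA; apply: h; exists w.
- move=> A G U D _ IH w [[/all_trueD[/all_true1/= h hG] hD] hU].
  by apply: (IH w); do !split=> //; rewrite !(all_trueD, all_true1).
- move=> A M N P Q U mM mN aP aQ _ IH w [[]].
  move=> /all_trueD[/all_trueD[/all_true1[x hA] hM] hP] /all_falseD[hQ hN] hU.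
  (* The witness [x] becomes the current world, and the world [w] left behind realises the block of
     its atoms. *)
  apply: (IH x); apply: refutes_add_block => //; last by exists w.
  do !split=> //; last exact: all_false_modal hN.
  by rewrite all_trueD all_true1; split=> //; apply: all_true_modal hM.
- move=> A M N P Q U mM mN aP aQ _ IH w [[]].
  move=> /all_trueD[hM hP] /all_falseD[/all_falseD[hQ hN] /all_false1].
  move=> /not_all_ex_not[x hA] hU.
  apply: (IH x); apply: refutes_add_block => //; last by exists w.
  do !split=> //; first exact: all_true_modal hM.
  by rewrite all_falseD all_false1; split=> //; apply: all_false_modal hN.
- move=> M N P Q P2 Q2 U mM mN aP aQ _ _ IH w /refutes_cons[[[]]].
  move=> /all_trueD[hM hP] /all_falseD[hQ hN] hU [x [hP2 hQ2]].
  (* The two worlds change places: [x], which realised the opened block, becomes current, and [w]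
     realises the new block. *)
  apply: (IH x); apply: refutes_add_block => //; last by exists w.
  do !split=> //; first by rewrite all_trueD; split=> //; apply: all_true_modal hM.
  by rewrite all_falseD; split=> //; apply: all_false_modal hN.
- move=> M N P Q P2 Q2 U mM mN aP aQ _ _ IH w /refutes_cons[[[]]].
  move=> /all_trueD[hM hP] /all_falseD[hQ hN] hU [x [hP2 hQ2]].
  apply: (IH x); apply: refutes_add_block => //; last by exists w.
  do !split=> //; first by rewrite all_trueD; split=> //; apply: all_true_modal hM.
  by rewrite all_falseD; split=> //; apply: all_false_modal hN.
Qed.

End Semantics.

(** * The calculus on signed formulas *)

(* [(true, A)] and [(false, A)] stand for A in the antecedent and in the
   succedent; a world is the signed list of the atoms of a block. *)
Definition sform : Type := (bool * form)%type.
Definition world : Type := seq sform.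

Implicit Types (X Y : sform) (L M P H B v : seq sform) (W : seq (mark * world)).

Definition lhs L : seq form := [seq X.2 | X <- L & X.1].
Definition rhs L : seq form := [seq X.2 | X <- L & ~~ X.1].

Definition block_of (kv : mark * world) : block :=
  (kv.1, seq_mset (lhs kv.2), seq_mset (rhs kv.2)).

Definition sequent_of L W : sequent :=
  (seq_mset (lhs L), seq_mset (map block_of W), seq_mset (rhs L)).

Definition prv L W := provable (sequent_of L W).

Definition satom X := atomic X.2.
Definition smodal X := modal X.2.

Definition world_ok (kv : mark * world) := all satom kv.2 && (kv.2 != [::]).

(** Follows the convention of [add_block] that an empty block is not added. *)
Definition add_world k P W := if P is [::] then W else (k, P) :: W.

(** The default value makes [inst] the identity off modal formulas, so that [sub_closed] can ask for
    closure under [inst] without a case distinction. *)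
Definition body A := match A with Dia A | Box A => A | _ => A end.

Definition inst X : sform := (X.1, body X.2).

(** Smullyan's nu formulas; [existential] gives the pi formulas. They let each pair of dual modal
    rules be treated as one. *)
Definition universal X :=
  match X with (s, Box _) => s | (s, Dia _) => ~~ s | _ => false end.
Definition existential X :=
  match X with (s, Dia _) => s | (s, Box _) => ~~ s | _ => false end.

(* The premises of the propositional rule with principal formula X, each as the
   list of its active formulas. *)
Definition branches X : seq (seq sform) :=
  match X with
  | (s, Neg A) => [:: [:: (~~ s, A)]]
  | (true, And A B) => [:: [:: (true, A); (true, B)]]
  | (false, And A B) => [:: [:: (false, A)]; [:: (false, B)]]
  | (true, Or A B) => [:: [:: (true, A)]; [:: (true, B)]]
  | (false, Or A B) => [:: [:: (false, A); (false, B)]]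
  | (true, Imp A B) => [:: [:: (false, A)]; [:: (true, B)]]
  | (false, Imp A B) => [:: [:: (true, A); (false, B)]]
  | _ => [::]
  end.

Definition compound A := ~~ atomic A && ~~ modal A.

Lemma lhs_cat L M : lhs (L ++ M) = lhs L ++ lhs M.
Proof. by rewrite /lhs filter_cat map_cat. Qed.

Lemma rhs_cat L M : rhs (L ++ M) = rhs L ++ rhs M.
Proof. by rewrite /rhs filter_cat map_cat. Qed.

Lemma all_lhs (a : pred form) L : all (fun X => a X.2) L -> all a (seq_mset (lhs L)).
Proof.
move=> /allP h; rewrite all_seq_mset; apply/allP => A /mapP[X].
by rewrite mem_filter => /andP[_ /h hX ->].
Qed.

Lemma all_rhs (a : pred form) L : all (fun X => a X.2) L -> all a (seq_mset (rhs L)).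
Proof.
move=> /allP h; rewrite all_seq_mset; apply/allP => A /mapP[X].
by rewrite mem_filter => /andP[_ /h hX ->].
Qed.

Lemma perm_sequent_of L L' W W' :
  perm_eq L L' -> perm_eq W W' -> sequent_of L W = sequent_of L' W'.
Proof.
move=> hL hW; rewrite /sequent_of; congr (_, _, _).
- by apply/eq_seq_msetP; rewrite perm_map // perm_filter.
- by apply/eq_seq_msetP; rewrite perm_map.
- by apply/eq_seq_msetP; rewrite perm_map // perm_filter.
Qed.

Lemma prv_perm L' W' L W : perm_eq L L' -> perm_eq W W' -> prv L' W' -> prv L W.
Proof. by move=> hL hW; rewrite /prv (perm_sequent_of hL hW). Qed.

Lemma empty_world v :
  empty_block (seq_mset (lhs v)) (seq_mset (rhs v)) = (v == [::]).
Proof.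
apply/idP/eqP => [/andP[/eqP hl /eqP hr] | ->]; last first.
  by rewrite /empty_block !seq_mset_nil eqxx.
case: v hl hr => // -[[] A] v.
  by rewrite /lhs /= mset_cons => /msetP/(_ A); rewrite mset1DE eqxx mset0E.
by rewrite /rhs /= mset_cons => _ /msetP/(_ A); rewrite mset1DE eqxx mset0E.
Qed.

Lemma block_of_ok kv : world_ok kv -> block_ok (block_of kv).
Proof.
case: kv => k v /andP[av nv]; rewrite /block_ok /= empty_world nv andbT.
by rewrite /all_atomic all_lhs ?all_rhs.
Qed.

Lemma middle_of_ok W : all world_ok W -> middle_ok (seq_mset (map block_of W)).
Proof.
move=> /allP h; rewrite /middle_ok all_seq_mset all_map; apply/allP => kv /h.
exact: block_of_ok.
Qed.

Lemma add_blockE k P L W : all satom P ->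
  add_block k (seq_mset (lhs P)) (seq_mset (rhs P)) (sequent_of L W) =
  sequent_of L (add_world k P W).
Proof.
move=> aP; rewrite /= empty_world; case: P aP => // X P aP.
by rewrite /all_atomic all_lhs ?all_rhs //= /sequent_of /= mset_cons.
Qed.

Lemma sequent_of_cons s A L W :
  sequent_of ((s, A) :: L) W =
  if s then (A +` seq_mset (lhs L), seq_mset (map block_of W), seq_mset (rhs L))
  else (seq_mset (lhs L), seq_mset (map block_of W), seq_mset (rhs L) `+` [mset A]).
Proof. by case: s; rewrite /sequent_of /= ?mset_cons // msetDC. Qed.

Lemma prv_id A L W : atomic A -> all world_ok W ->
  (true, A) \in L -> (false, A) \in L -> prv L W.
Proof.
move=> aA oW h1 h2; have h2' : (false, A) \in rem (true, A) L 
  by move: h2; rewrite (perm_mem (perm_to_rem h1)).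
have hL : perm_eq L [:: (true, A), (false, A) & rem (false, A) (rem (true, A) L)].
  by apply: perm_trans (perm_to_rem h1) _; rewrite perm_cons perm_to_rem.
apply: (prv_perm hL (perm_refl W)).
rewrite /prv sequent_of_cons /rhs /= mset_cons [X in (_, _, X)]msetDC.
exact: Ax aA (middle_of_ok oW).
Qed.

Lemma prv_bot L W : all world_ok W -> (true, Bot) \in L -> prv L W.
Proof.
move=> oW /perm_to_rem h; apply: (prv_perm h (perm_refl W)).
by rewrite /prv sequent_of_cons; apply: LBot (middle_of_ok oW).
Qed.

(** Packs the eight propositional rules into one, so that the search need not distinguish
    connectives. *)
Lemma prv_branches X L W : compound X.2 ->
  (forall b, b \in branches X -> prv (b ++ L) W) -> prv (X :: L) W.
Proof.
have e s A : sequent_of ([:: (s, A)] ++ L) W = sequent_of ((s, A) :: L) W by [].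
case: X => -[] [|?|A|A B|A B|A B|A|A] //= _ h; rewrite /prv sequent_of_cons.
- by apply: LNeg; have := h _ (mem_head _ _); rewrite /prv e sequent_of_cons.
- apply: LAnd; have := h _ (mem_head _ _).
  by rewrite /prv /sequent_of /lhs /= !mset_cons msetDA.
- apply: LOr; [have := h _ (mem_head _ _) | have := h _ (mem_last _ _)].
    by rewrite /prv e sequent_of_cons.
  by rewrite /prv e sequent_of_cons.
- apply: LImp; [have := h _ (mem_head _ _) | have := h _ (mem_last _ _)].
    by rewrite /prv e sequent_of_cons.
  by rewrite /prv e sequent_of_cons.
- by apply: RNeg; have := h _ (mem_head _ _); rewrite /prv e sequent_of_cons.
- apply: RAnd; [have := h _ (mem_head _ _) | have := h _ (mem_last _ _)].
    by rewrite /prv e sequent_of_cons.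
  by rewrite /prv e sequent_of_cons.
- apply: ROr; have := h _ (mem_head _ _).
  by rewrite /prv /sequent_of /rhs /= !mset_cons msetDA msetDC.
- apply: RImp; have := h _ (mem_head _ _).
  by rewrite /prv /sequent_of /rhs /lhs /= !mset_cons (msetDC [mset B]).
Qed.

Lemma prv_universal X L W : universal X -> prv (inst X :: X :: L) W -> prv (X :: L) W.
Proof.
case: X => -[] [|?|A|A B|A B|A B|A|A] //= _; rewrite /prv !sequent_of_cons.
  rewrite /sequent_of /lhs /= !mset_cons msetDA; exact: LBox.
rewrite /rhs /= mset_cons (msetDC [mset Dia A]) -msetDA; exact: RDia.
Qed.

(** Joins [LDia] and [RBox]. The principal formula is absent from the premise, which is why the
    search has to remember it separately. *)
Lemma prv_existential X M P W : existential X -> all smodal M -> all satom P ->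
  prv (inst X :: M) (add_world (if X.1 then BoxMark else DiaMark) P W) ->
  prv (X :: M ++ P) W.
Proof.
move=> eX mM aP; rewrite /inst.
case: X eX => -[] [|?|A|A B|A B|A B|A|A] //= _;
  rewrite /prv -add_blockE // !sequent_of_cons.
  rewrite lhs_cat rhs_cat !seq_mset_cat msetDA (msetDC (seq_mset (rhs M))).
  by apply: LDia; rewrite /all_modal /all_atomic ?all_lhs ?all_rhs.
rewrite lhs_cat rhs_cat !seq_mset_cat (msetDC (seq_mset (rhs M)) (seq_mset (rhs P))).
by apply: RBox; rewrite /all_modal /all_atomic ?all_lhs ?all_rhs.
Qed.

Definition flip k := if k is DiaMark then BoxMark else DiaMark.

(** Joins [LDiaSemi] and [RBoxSemi]: read upwards, the opened block becomes current and the atoms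
    [P] are stored under the opposite mark. *)
Lemma prv_move k v M P W : world_ok (k, v) -> all smodal M -> all satom P ->
  prv (M ++ v) (add_world (flip k) P W) -> prv (M ++ P) ((k, v) :: W).
Proof.
move=> /block_of_ok ov mM aP; rewrite /prv -add_blockE //.
rewrite [sequent_of (M ++ v) _]/sequent_of [sequent_of (M ++ P) _]/sequent_of.
rewrite !lhs_cat !rhs_cat !seq_mset_cat /= mset_cons.
rewrite !(msetDC (seq_mset (rhs M))).
case: k ov => ov; [apply: LDiaSemi | apply: RBoxSemi] => //;
  by rewrite /all_modal /all_atomic ?all_lhs ?all_rhs.
Qed.

(** * Propositional saturation *)

(** Decomposition discards compound formulas; this evaluation recovers them from the signed atoms
    and modal formulas that remain in [B]. *)
Fixpoint forced B (s : bool) (A : form) : bool :=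
  match A with
  | Neg A => forced B (~~ s) A
  | And A1 A2 =>
      if s then forced B s A1 && forced B s A2 else forced B s A1 || forced B s A2
  | Or A1 A2 =>
      if s then forced B s A1 || forced B s A2 else forced B s A1 && forced B s A2
  | Imp A1 A2 =>
      if s then forced B false A1 || forced B s A2
      else forced B true A1 && forced B s A2
  | _ => (s, A) \in B
  end.

Definition forces B X := forced B X.1 X.2.

Lemma forces_sub B B' X : {subset B <= B'} -> forces B X -> forces B' X.
Proof.
move=> sB; case: X => s A; rewrite /forces /=.
elim: A s => [|n|A IHA|A IHA C IHC|A IHA C IHC|A IHA C IHC|A _|A _] s //=;
  try exact: sB; try exact: IHA.
- by case: s => [/andP[/IHA-> /IHC->] | /orP[/IHA-> | /IHC->]] //; rewrite orbT.
- by case: s => [/orP[/IHA-> | /IHC->] | /andP[/IHA-> /IHC->]] //; rewrite orbT.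
- by case: s => [/orP[/IHA-> | /IHC->] | /andP[/IHA-> /IHC->]] //; rewrite orbT.
Qed.

Lemma forces_branch B X b : b \in branches X -> all (forces B) b -> forces B X.
Proof.
case: X => -[] [|?|A|A C|A C|A C|A|A] //=; rewrite !inE => hb;
  move: hb; do ?[case/orP] => /eqP->; rewrite /forces /= ?andbT //;
  by move=> ->; rewrite ?orbT.
Qed.

Lemma forces_basic B X : ~~ compound X.2 -> forces B X = (X \in B).
Proof. by case: X => s []. Qed.

Fixpoint form_size A : nat :=
  match A with
  | Neg A | Dia A | Box A => (form_size A).+1
  | And A B | Or A B | Imp A B => (form_size A + form_size B).+1
  | _ => 1
  end.

Definition list_size L := sumn [seq form_size X.2 | X <- L].

Lemma list_size_branch X b : b \in branches X -> list_size b < form_size X.2.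
Proof.
by case: X => -[] [|?|A|A C|A C|A C|A|A] //=; rewrite !inE;
  do ?[case/orP]; move=> /eqP->; rewrite /list_size /=; lia.
Qed.

Definition sub_closed (C : seq form) :=
  forall X, X.2 \in C ->
  (inst X).2 \in C /\ forall b, b \in branches X -> all (fun Y => Y.2 \in C) b.

Ltac solve_perm :=
  apply/permP => ?; rewrite -?cats1 ?(count_cat, cat_cons) /= ?(count_cat, cat_cons) /=; lia.

(** Read upwards, an unprovable conclusion has an unprovable premise. Each step lowers the size of
    the pending list [L], either by splitting a compound formula or by moving a modal one to [M] or
    an atom to [P]. *)
Lemma decompose C L M P W :
  sub_closed C -> all (fun X => X.2 \in C) L -> ~ prv (L ++ M ++ P) W ->
  exists M1 P1, [/\ all smodal M1, all satom P1, all (fun X => X.2 \in C) M1,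
    ~ prv ((M1 ++ M) ++ (P1 ++ P)) W & all (forces (M1 ++ P1)) L].
Proof.
move=> clC; have [n] := ubnP (list_size L).
elim: n => // n IH in L M P *; case: L => [|X L] hn.
  by move=> _ h; exists [::], [::].
move=> /andP[hX]; rewrite -/(all _ L) => hL nprv.
have size0 : 0 < form_size X.2 by case: (X.2).
have hn' : list_size L < n by move: hn; rewrite /list_size /=; lia.
have [cX | bX] := boolP (compound X.2).
  (* Contrapositive of [prv_branches]: one of the branches stays unprovable. *)
  have [b hb nb] : exists2 b, b \in branches X & ~ prv ((b ++ L) ++ M ++ P) W.
    apply: NNPP => h; apply: nprv; apply: prv_branches cX _ => b hb.
    by apply: NNPP => nb; apply: h; exists b; rewrite // -catA.
  have [||M1 [P1 [h1 h2 h3 h4]]] := IH _ _ _ _ _ nb.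
  - have := list_size_branch hb; move: hn.
    by rewrite /list_size /= map_cat sumn_cat; lia.
  - by rewrite all_cat hL andbT; have [_] := clC _ hX; apply.
  rewrite all_cat => /andP[fb fL]; exists M1, P1; split=> //=.
  by rewrite fL andbT (forces_branch hb).
have [aX | naX] := boolP (atomic X.2).
  have [|M1 [P1 [h1 h2 h3 h4 h5]]] := IH L M (X :: P) hn' hL.
    by move=> h; apply: nprv; apply: prv_perm h => //; solve_perm.
  exists M1, (rcons P1 X); split=> //.
  - by rewrite all_rcons h2 andbT.
  - by rewrite cat_rcons.
  rewrite /= forces_basic // mem_cat mem_rcons mem_head orbT /=.
  apply: sub_all h5 => Y; apply: forces_sub => Z.
  by rewrite !mem_cat mem_rcons inE => /orP[]->; rewrite ?orbT.
have mX : modal X.2 by move: bX naX; rewrite /compound; case: atomic; case: modal.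
have [|M1 [P1 [h1 h2 h3 h4 h5]]] := IH L (X :: M) P hn' hL.
  by move=> h; apply: nprv; apply: prv_perm h => //; solve_perm.
exists (rcons M1 X), P1; split=> //.
- by rewrite all_rcons h1 andbT.
- by rewrite all_rcons h3 andbT.
- by rewrite cat_rcons.
rewrite /= forces_basic // mem_cat mem_rcons mem_head /=.
apply: sub_all h5 => Y; apply: forces_sub => Z.
by rewrite !mem_cat mem_rcons inE => /orP[]->; rewrite ?orbT.
Qed.

(** * Subformula closure *)

Fixpoint subforms A : seq form :=
  A :: match A with
  | Neg A | Dia A | Box A => subforms A
  | And A B | Or A B | Imp A B => subforms A ++ subforms B
  | _ => [::]
  end.

Lemma subforms_refl A : A \in subforms A.
Proof. by case: A => *; apply: mem_head. Qed.

Lemma subforms_trans (A B : form) : B \in subforms A -> {subset subforms B <= subforms A}.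
Proof.
elim: A => [|n|A IHA|A IHA C IHC|A IHA C IHC|A IHA C IHC|A IHA|A IHA] /=;
  rewrite in_cons => /predU1P[-> //|]; rewrite // ?mem_cat.
all: try by move=> /IHA h D /h; rewrite inE orbC => ->.
all: by move=> /orP[/IHA | /IHC] h D /h; rewrite inE mem_cat => ->; rewrite ?orbT.
Qed.

Lemma sub_closed_subforms L :
  sub_closed (flatten [seq subforms X.2 | X <- L]).
Proof.
move=> X /flatten_mapP[Y hY hX].
have hs D : D \in subforms X.2 -> D \in flatten [seq subforms X.2 | X <- L].
  by move=> hD; apply/flatten_mapP; exists Y => //; apply: subforms_trans hX _ hD.
have r := subforms_refl; case: X {hX} hs => -[] [|?|A|A B|A B|A B|A|A] /= hs;
  (split; first by apply: hs; rewrite ?inE ?eqxx ?r ?orbT);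
  move=> b; rewrite // !inE; do ?[case/orP]; move=> /eqP->; rewrite /= ?andbT;
  by rewrite ?hs // inE ?mem_cat r ?orbT.
Qed.

(** * Saturation over all worlds *)

Definition worlds P W : seq world := P :: map snd W.

(** The memory [H] holds modal formulas, which are common to all worlds; hence it is joined to the
    atoms of each [v]. *)
Definition witnessed H (Vs : seq world) X := has (fun v => forces (H ++ v) (inst X)) Vs.

(* M consists of the formulas of H still present in the sequent: an existential
   formula leaves it when it receives its witness, a universal one never does. *)
Record state (C : seq form) H M P W : Prop := State {
  state_modal : all smodal H;
  state_sub : {subset M <= H};
  state_closed : all (fun X => X.2 \in C) H;
  state_universal : forall X, X \in H -> universal X -> X \in M;
  state_existential : forall X, X \in H -> existential X ->
    X \in M \/ witnessed H (worlds P W) X;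
  state_atomic : all satom P;
  state_ok : all world_ok W;
  state_nprv : ~ prv (M ++ P) W }.

(** Memory and worlds only grow along this relation, so forcing and witnesses persist. Inclusion of
    worlds allows them to be permuted and empty ones to be dropped. *)
Definition covers H' (Vs' : seq world) H (Vs : seq world) :=
  {subset H <= H'} /\
  forall v, v \in Vs -> exists2 v', v' \in Vs' & {subset v <= v'}.

Lemma covers_trans H2 V2 H1 V1 H3 V3 :
  covers H3 V3 H2 V2 -> covers H2 V2 H1 V1 -> covers H3 V3 H1 V1.
Proof.
move=> [s32 c32] [s21 c21]; split=> [X /s21/s32 // | v /c21[v2 /c32[v3 h3 s3] s2]].
by exists v3 => // X /s2/s3.
Qed.

Lemma covers_refl H Vs : covers H Vs H Vs.
Proof. by split=> // v; exists v. Qed.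

Lemma covers_witnessed H' Vs' H Vs X :
  covers H' Vs' H Vs -> witnessed H Vs X -> witnessed H' Vs' X.
Proof.
move=> [sH c] /hasP[v /c[v' hv' sv] f]; apply/hasP; exists v' => //.
by apply: forces_sub f => Y; rewrite !mem_cat => /orP[/sH-> | /sv->] //; rewrite orbT.
Qed.

(** * Termination measures *)

Definition sforms (C : seq form) : seq sform :=
  [seq (s, A) | s <- [:: true; false], A <- C].

Lemma mem_sforms C X : (X \in sforms C) = (X.2 \in C).
Proof.
case: X => s A; apply/allpairsP/idP => [[[t B] /= [_ hB [_ ->]]] // | hA].
by exists (s, A); split=> //=; case: (s).
Qed.

(** The count runs over the fixed set [sforms C] and not over the memory, so a growing [H] cannot
    increase it. *)
Definition unwitnessed C H Vs :=
  count (fun X => existential X && ~~ witnessed H Vs X) (sforms C).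

Definition unforced_at C H v :=
  count (fun X => universal X && ~~ forces (H ++ v) (inst X)) (sforms C).

Definition unforced C H (Vs : seq world) := sumn (map (unforced_at C H) Vs).

Lemma count_lt (T : eqType) (a b : pred T) (s : seq T) x :
  subpred a b -> x \in s -> b x -> ~~ a x -> count a s < count b s.
Proof.
move=> sab; elim: s => //= y s IH; rewrite inE => /predU1P[-> bx | hx bx] ax.
  by rewrite bx (negPf ax) /= add0n add1n ltnS sub_count.
by rewrite -addnS leq_add ?IH //; have := sab y; case: (a y) => // ->.
Qed.

Lemma unwitnessed_le C H' Vs' H Vs :
  covers H' Vs' H Vs -> unwitnessed C H' Vs' <= unwitnessed C H Vs.
Proof.
move=> c; apply: sub_count => X /andP[-> /=]; apply: contra.
exact: covers_witnessed.
Qed.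

Lemma unwitnessed_lt C H' Vs' H Vs X :
  covers H' Vs' H Vs -> X.2 \in C -> existential X ->
  ~~ witnessed H Vs X -> witnessed H' Vs' X ->
  unwitnessed C H' Vs' < unwitnessed C H Vs.
Proof.
move=> c hX eX nX wX; apply: (@count_lt _ _ _ _ X); rewrite ?mem_sforms ?eX ?wX //.
by move=> Y /andP[-> /=]; apply: contra; apply: covers_witnessed.
Qed.

Lemma unforced_at_le C H' H v' v :
  {subset H <= H'} -> {subset v <= v'} -> unforced_at C H' v' <= unforced_at C H v.
Proof.
move=> sH sv; apply: sub_count => X /andP[-> /=]; apply: contra.
by apply: forces_sub => Y; rewrite !mem_cat => /orP[/sH-> | /sv->] //; rewrite orbT.
Qed.

Lemma unforced_at_lt C H' H v' v X :
  {subset H <= H'} -> {subset v <= v'} -> X.2 \in C -> universal X ->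
  ~~ forces (H ++ v) (inst X) -> forces (H' ++ v') (inst X) ->
  unforced_at C H' v' < unforced_at C H v.
Proof.
move=> sH sv hX uX nX fX; apply: (@count_lt _ _ _ _ X); rewrite ?mem_sforms ?uX ?fX //.
move=> Y /andP[-> /=]; apply: contra; apply: forces_sub => Z.
by rewrite !mem_cat => /orP[/sH-> | /sv->] //; rewrite orbT.
Qed.

Lemma unforced_le C H' H Vs : {subset H <= H'} -> unforced C H' Vs <= unforced C H Vs.
Proof.
move=> sH; rewrite /unforced; elim: Vs => //= v Vs IH.
by apply: leq_add IH; apply: unforced_at_le.
Qed.

(** * Single steps of the search *)

Lemma add_world_ok k P W : all satom P -> all world_ok W -> all world_ok (add_world k P W).
Proof. by case: P => //= X P aP ->; rewrite /world_ok /= aP. Qed.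

Lemma universalN_existential X : universal X -> ~~ existential X.
Proof. by case: X => -[] []. Qed.

(* An empty world is not stored as a block, but every world covers it. *)
Lemma covers_new_world k H' P' P W H : {subset H <= H'} ->
  covers H' (worlds P' (add_world k P W)) H (worlds P W).
Proof.
move=> sH; split=> // v; rewrite inE => /predU1P[-> | hv].
  case: P => [|X P]; first by exists P'; rewrite ?mem_head.
  by exists (X :: P); rewrite // !inE eqxx orbT.
by exists v => //; case: P => [|X P]; rewrite !inE hv ?orbT.
Qed.

Lemma state_move C H M P W k v : state C H M P W -> (k, v) \in W ->
  exists W', [/\ state C H M v W', covers H (worlds v W') H (worlds P W)
    & unforced C H (worlds v W') <= unforced C H (worlds P W)].
Proof.
move=> st hv; have [mH sM cH uH eH aP oW np] := st.
have pW := perm_to_rem hv; set W0 := rem _ W in pW.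
have [ov oW0] : world_ok (k, v) /\ all world_ok W0.
  by apply/andP; rewrite -[_ && _]/(all world_ok ((k, v) :: W0)) -(perm_all _ pW).
have mM : all smodal M by apply/allP => X /sM; apply/allP.
exists (add_world (flip k) P W0).
have c : covers H (worlds v (add_world (flip k) P W0)) H (worlds P W).
  have c1 : covers H (worlds v (add_world (flip k) P W0)) H (worlds P W0).
    exact: covers_new_world.
  split=> // w; rewrite inE => /predU1P[-> | /mapP[[l u] hu ->]].
    by case: c1 => _; apply; rewrite mem_head.
  move: hu; rewrite (perm_mem pW) inE => /predU1P[[_ ->] | hu].
    by exists v; rewrite ?mem_head.
  by case: c1 => _; apply; rewrite inE (map_f snd hu) orbT.
split=> //; last first.
  rewrite /unforced /= (perm_sumn (perm_map _ (perm_map _ pW))) /=.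
  (* An empty [P] is not stored, so the sum loses a summand; otherwise two summands are
     exchanged. *)
  by case: (P) => [|X P'] /=; [apply: leq_addl | rewrite addnCA].
split=> //.
- by move=> X hX eX; case: (eH X hX eX) => [|w]; [left|right; apply: covers_witnessed w].
- by case/andP: ov.
- exact: add_world_ok.
move=> h; apply: np; apply: (prv_perm (perm_refl _) pW).
exact: prv_move.
Qed.

(** A universal formula never leaves [M], so its rule still applies. Decomposing the instance makes
    it forced at the current world, and no other world changes. *)
Lemma state_add_universal C H M P W X : sub_closed C -> state C H M P W ->
  X \in H -> universal X -> ~~ forces (H ++ P) (inst X) ->
  exists H' M' P', [/\ state C H' M' P' W, covers H' (worlds P' W) H (worlds P W)
    & unforced C H' (worlds P' W) < unforced C H (worlds P W)].
Proof.
move=> clC [mH sM cH uH eH aP oW np] hX uX nX; have XM := uH _ hX uX.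
have XC := allP cH _ hX; have [iC _] := clC _ XC.
have [||M1 [P1 [mM1 aP1 cM1 np1 /andP[f1 _]]]] := @decompose C [:: inst X] M P W clC.
- by rewrite /= iC.
- move=> h; apply: np; have pM := perm_to_rem XM; set M0 := rem X M in pM.
  apply: (@prv_perm (X :: M0 ++ P) W) => //; first by rewrite -cat_cons perm_cat2r.
  apply: prv_universal => //; apply: prv_perm h => //.
  by rewrite /= perm_cons -cat_cons perm_cat2r perm_sym.
(* New modal formulas enter both memory and sequent; new atoms enlarge the current world. *)
exists (M1 ++ H), (M1 ++ M), (P1 ++ P).
have sH : {subset H <= M1 ++ H} by move=> Y hY; rewrite mem_cat hY orbT.
have sP : {subset P <= P1 ++ P} by move=> Y hY; rewrite mem_cat hY orbT.
have c : covers (M1 ++ H) (worlds (P1 ++ P) W) H (worlds P W).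
  split=> // v; rewrite inE => /predU1P[-> | hv]; first by exists (P1 ++ P); rewrite ?mem_head.
  by exists v; rewrite // inE hv orbT.
split=> //.
  split=> //.
  - by rewrite all_cat mM1.
  - by move=> Y; rewrite !mem_cat => /orP[-> | /sM->]; rewrite ?orbT.
  - by rewrite all_cat cM1.
  - by move=> Y; rewrite !mem_cat => /orP[-> // | hY uY]; rewrite (uH _ hY uY) orbT.
  - move=> Y; rewrite !mem_cat => /orP[-> | hY eY]; first by left.
    case: (eH Y hY eY) => [-> | w]; [by left; rewrite orbT | right].
    exact: covers_witnessed w.
  - by rewrite all_cat aP1.
rewrite /unforced /= -addSn leq_add //; last exact: unforced_le.
apply: (@unforced_at_lt _ _ _ _ _ X) => //; apply: forces_sub f1 => Y.
by rewrite !mem_cat => /orP[]->; rewrite ?orbT.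
Qed.

(** Lacking a witness, [X] must still be in [M], so its rule applies. The new world starts without
    atoms and receives the decomposed body of [X]. *)
Lemma state_add_world C H M P W X : sub_closed C -> state C H M P W ->
  X \in H -> existential X -> ~~ witnessed H (worlds P W) X ->
  exists H' M' P' W', [/\ state C H' M' P' W', covers H' (worlds P' W') H (worlds P W)
    & unwitnessed C H' (worlds P' W') < unwitnessed C H (worlds P W)].
Proof.
move=> clC [mH sM cH uH eH aP oW np] hX eX nX.
have XM : X \in M by case: (eH _ hX eX) => // w; rewrite w in nX.
have XC := allP cH _ hX; have [iC _] := clC _ XC.
have pM := perm_to_rem XM; set M0 := rem X M in pM.
have mM0 : all smodal M0 by apply/allP => Y /mem_rem/sM; apply/allP.
set W' := add_world (if X.1 then BoxMark else DiaMark) P W.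
have [||M1 [P1 [mM1 aP1 cM1 np1 /andP[f1 _]]]] := @decompose C [:: inst X] M0 [::] W' clC.
- by rewrite /= iC.
- rewrite cats0 => h; apply: np.
  apply: (@prv_perm (X :: M0 ++ P) W) => //; first by rewrite -cat_cons perm_cat2r.
  exact: prv_existential.
(* [X] is gone from the sequent, as [M0] replaces [M], but stays in the memory. *)
rewrite cats0 in np1; exists (M1 ++ H), (M1 ++ M0), P1, W'.
have sH : {subset H <= M1 ++ H} by move=> Y hY; rewrite mem_cat hY orbT.
have c : covers (M1 ++ H) (worlds P1 W') H (worlds P W) by apply: covers_new_world.
have wX : witnessed (M1 ++ H) (worlds P1 W') X.
  apply/hasP; exists P1; first exact: mem_head.
  by apply: forces_sub f1 => Y; rewrite !mem_cat => /orP[]->; rewrite ?orbT.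
split=> //; last by apply: unwitnessed_lt c XC eX nX wX.
split=> //.
- by rewrite all_cat mM1.
- by move=> Y; rewrite !mem_cat => /orP[-> // | /mem_rem/sM->]; rewrite orbT.
- by rewrite all_cat cM1.
- move=> Y; rewrite !mem_cat => /orP[-> // | hY uY].
  have := uH _ hY uY; rewrite (perm_mem pM) inE => /predU1P[eYX | ->]; last by rewrite orbT.
  by move: (universalN_existential uY); rewrite eYX eX.
- move=> Y; rewrite !mem_cat => /orP[-> | hY eY]; first by left.
  case: (eH Y hY eY) => [| w]; last by right; apply: covers_witnessed w.
  (* The only formula removed from [M] is [X], which now has the witness [P1]. *)
  rewrite (perm_mem pM) inE => /predU1P[-> | ->]; first by right.
  by left; rewrite orbT.
- exact: add_world_ok.
Qed.

Definition saturated H (Vs : seq world) :=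
  (forall X, X \in H -> existential X -> witnessed H Vs X) /\
  (forall X v, X \in H -> universal X -> v \in Vs -> forces (H ++ v) (inst X)).

(* Lexicographic descent: a new world decreases [unwitnessed], an instantiation
   decreases [unforced] and does not increase [unwitnessed]. *)
Lemma saturate C H M P W : sub_closed C -> state C H M P W ->
  exists H' M' P' W', [/\ state C H' M' P' W', covers H' (worlds P' W') H (worlds P W)
    & saturated H' (worlds P' W')].
Proof.
move=> clC; have [n] := ubnP (unwitnessed C H (worlds P W)).
elim: n => // n IHn in H M P W *.
have [m] := ubnP (unforced C H (worlds P W)).
elim: m => // m IHm in H M P W * => hm hn st.
have [[X [hX eX nX]] | hex] :=
    classic (exists X, [/\ X \in H, existential X & ~~ witnessed H (worlds P W) X]).
  have [H1 [M1 [P1 [W1 [st1 c1 lt1]]]]] := state_add_world clC st hX eX nX.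
  have [|H2 [M2 [P2 [W2 [st2 c2 s2]]]]] := IHn _ _ _ _ _ st1; first by lia.
  by exists H2, M2, P2, W2; split=> //; apply: covers_trans c2 c1.
have [[X [v [hX uX hv nX]]] | huni] := classic (exists X v,
    [/\ X \in H, universal X, v \in worlds P W & ~~ forces (H ++ v) (inst X)]).
  (* Instantiation happens at the current world only, so [v] is made current first. *)
  have [W0 [st0 c0 le0]] : exists W0, [/\ state C H M v W0,
      covers H (worlds v W0) H (worlds P W)
      & unforced C H (worlds v W0) <= unforced C H (worlds P W)].
    move: hv; rewrite inE => /predU1P[-> | /mapP[[k u] hu ->]].
      by exists W; split=> //; apply: covers_refl.
    exact: state_move hu.
  have [H1 [M1 [P1 [st1 c1 lt1]]]] := state_add_universal clC st0 hX uX nX.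
  have c := covers_trans c1 c0.
  have [||H2 [M2 [P2 [W2 [st2 c2 s2]]]]] := IHm _ _ _ _ _ _ st1; first by lia.
    by have := unwitnessed_le C c; lia.
  by exists H2, M2, P2, W2; split=> //; apply: covers_trans c2 c.
exists H, M, P, W; split=> //; first exact: covers_refl.
split=> [X hX eX | X v hX uX hv]; apply/negPn/negP => h.
  by apply: hex; exists X.
by apply: huni; exists X, v.
Qed.

(** * Completeness *)

(** Axioms inspect the outer part only; but every world can be made current, and a clash there would
    make the sequent provable. *)
Lemma state_consistent C H M P W v : state C H M P W -> v \in worlds P W ->
  [/\ all satom v, (true, Bot) \notin v &
    forall A, atomic A -> (true, A) \in v -> (false, A) \notin v].
Proof.
move=> st hv.
have [W' [mH sM _ _ _ av oW np]] : exists W', state C H M v W'.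
  move: hv; rewrite inE => /predU1P[-> | /mapP[[k u] hu ->]]; first by exists W.
  by have [W' [st' _ _]] := state_move st hu; exists W'.
split=> //.
  by apply/negP => h; apply: np; apply: prv_bot; rewrite // mem_cat h orbT.
move=> A aA h1; apply/negP => h2; apply: np.
by apply: (prv_id aA); rewrite // mem_cat ?h1 ?h2 orbT.
Qed.

Definition valuation (Vs : seq world) (v : {v | v \in Vs}) (n : nat) : Prop :=
  (true, Var n) \in sval v.

(** The truth lemma, for both signs at once. Atoms rest on consistency of the worlds, modal formulas
    on saturation. *)
Lemma truth C H M P W : state C H M P W -> saturated H (worlds P W) ->
  forall A s (v : {v | v \in worlds P W}),
  forced (H ++ sval v) s A ->
  if s then holds (@valuation _) v A else ~ holds (@valuation _) v A.
Proof.
move=> st [sat_ex sat_un]; have mH := state_modal st.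
(* Memory holds only modal formulas and worlds only atoms, so the shape of a formula decides in
   which part of [H ++ v] it lies. *)
have nH s A : ~~ modal A -> (s, A) \notin H.
  by apply: contra => /(allP mH).
have nv s A v : v \in worlds P W -> modal A -> (s, A) \notin v.
  move=> hv mA; have [av _ _] := state_consistent st hv.
  by apply/negP => /(allP av); rewrite /satom; case: A mA.
elim=> [|n|A IH|A IHA B IHB|A IHA B IHB|A IHA B IHB|A IH|A IH] s [v hv] /=.
- rewrite mem_cat (negPf (nH _ _ _)) //=; have [_ nb _] := state_consistent st hv.
  by case: s => h; [rewrite h in nb | case].
- rewrite mem_cat (negPf (nH _ _ _)) //= /valuation /=.
  have [_ _ cons] := state_consistent st hv.
  case: s => // hf ht.
  by have := cons (Var n) isT ht; rewrite hf.
- by case: s => /(IH _ (exist _ v hv)) //= h; apply.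
- case: s => [/andP[/(IHA true (exist _ v hv)) h1 /(IHB true (exist _ v hv)) h2]
             | /orP[/(IHA false (exist _ v hv)) | /(IHB false (exist _ v hv))]];
    intuition.
- case: s => [/orP[/(IHA true (exist _ v hv)) | /(IHB true (exist _ v hv))]
             | /andP[/(IHA false (exist _ v hv)) h1 /(IHB false (exist _ v hv)) h2]];
    intuition.
- case: s => [/orP[/(IHA false (exist _ v hv)) | /(IHB true (exist _ v hv))]
             | /andP[/(IHA true (exist _ v hv)) h1 /(IHB false (exist _ v hv)) h2]];
    intuition.
- rewrite mem_cat (negPf (nv _ _ v hv _)) // orbF; case: s => h.
    have /hasP[u hu fu] := sat_ex _ h isT.
    by exists (exist _ u hu); apply: (IH true (exist _ u hu) fu).
  by case=> [[u hu]]; apply: (IH false (exist _ u hu) (sat_un _ _ h isT hu)).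
- rewrite mem_cat (negPf (nv _ _ v hv _)) // orbF; case: s => h.
    by case=> u hu; apply: (IH true (exist _ u hu) (sat_un _ _ h isT hu)).
  have /hasP[u hu fu] := sat_ex _ h isT.
  by move=> /(_ (exist _ u hu)); apply: (IH false (exist _ u hu) fu).
Qed.

Lemma mem_lhs A L : (A \in lhs L) = ((true, A) \in L).
Proof.
apply/mapP/idP => [[[s B]] | h]; last by exists (true, A); rewrite // mem_filter.
by rewrite mem_filter => /andP[/=]; case: s => // _ hB ->.
Qed.

Lemma mem_rhs A L : (A \in rhs L) = ((false, A) \in L).
Proof.
apply/mapP/idP => [[[s B]] | h]; last by exists (false, A); rewrite // mem_filter.
by rewrite mem_filter => /andP[/=]; case: s => // _ hB ->.
Qed.

Lemma countermodel L W : all world_ok W -> ~ prv L W ->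
  exists (T : Type) (V : T -> nat -> Prop) (w : T), refutes V w (sequent_of L W).
Proof.
move=> oW np; pose C := flatten [seq subforms X.2 | X <- L].
have clC : sub_closed C by apply: sub_closed_subforms.
have [||M1 [P1 [mM aP cM np1 fL]]] := @decompose C L [::] [::] W clC.
- apply/allP => X hX; apply/flatten_mapP; exists X => //; exact: subforms_refl.
- by rewrite !cats0.
rewrite !cats0 in np1.
(* No formula has been consumed yet, so memory and modal part coincide. *)
have st : state C M1 M1 P1 W by split=> // X; left.
have [H [M [P [W' [st' [sH cov] sat]]]]] := saturate clC st.
have truth := truth st' sat.
(* The search may end at another world; [v] is what the initial current world has grown into. *)
have [v hv sv] := cov P1 (mem_head _ _).
have holdsL s A : (s, A) \in L -> 
      if s then holds (@valuation _) (exist _ v hv) A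
      else ~ holds (@valuation _) (exist _ v hv) A.
  move=> /(allP fL) f; apply: truth; apply: (@forces_sub _ _ (s, A) _ f) => Y.
  by rewrite !mem_cat => /orP[/sH-> | /sv->] //; rewrite orbT.
exists {v | v \in worlds P W'}, (@valuation _), (exist _ v hv); split.
  by split=> A; rewrite mem_seq_mset ?mem_lhs ?mem_rhs => /holdsL.
move=> b; rewrite mem_seq_mset => /mapP[[k u] hu ->] /=.
have /andP[au _] := allP oW _ hu.
have [|v' hv' su] := cov u; first by rewrite inE (map_f snd hu) orbT.
exists (exist _ v' hv').
have holdsu s A : (s, A) \in u -> 
      if s then holds (@valuation _) (exist _ v' hv') A
      else ~ holds (@valuation _) (exist _ v' hv') A.
  move=> h; apply: truth; apply: (_ : is_true (forces _ (s, A))).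
  rewrite forces_basic ?mem_cat ?su ?orbT //.
  by have := allP au _ h; rewrite /satom /compound /= => ->.
by split=> A; rewrite mem_seq_mset ?mem_lhs ?mem_rhs => /holdsu.
Qed.

Definition signed (P Q : {mset form}) : seq sform :=
  [seq (true, A) | A <- P] ++ [seq (false, A) | A <- Q].

Lemma lhs_map_pair s (r : seq form) :
  lhs [seq (s, A) | A <- r] = if s then r else [::].
Proof. by rewrite /lhs; case: s; elim: r => //= A r ->. Qed.

Lemma rhs_map_pair s (r : seq form) :
  rhs [seq (s, A) | A <- r] = if s then [::] else r.
Proof. by rewrite /rhs; case: s; elim: r => //= A r ->. Qed.

Lemma lhs_signed (P Q : {mset form}) : seq_mset (lhs (signed P Q)) = P.
Proof. by rewrite lhs_cat !lhs_map_pair cats0 seq_mset_id. Qed.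

Lemma rhs_signed (P Q : {mset form}) : seq_mset (rhs (signed P Q)) = Q.
Proof. by rewrite rhs_cat !rhs_map_pair seq_mset_id. Qed.

(** Contrapositive of [countermodel], once the sequent is written with signed lists. *)
Lemma completeness (s : sequent) : middle_ok s.1.2 ->
  (forall (T : Type) (V : T -> nat -> Prop) w, ~ refutes V w s) -> provable s.
Proof.
case: s => [[G U] D] /= oU valid; pose W := [seq (b.1.1, signed b.1.2 b.2) | b <- U].
have e : sequent_of (signed G D) W = (G ;; U |-- D).
  rewrite /sequent_of lhs_signed rhs_signed; congr (_, _, _).
  rewrite -[RHS]seq_mset_id -map_comp; congr seq_mset.
  by apply: map_id_in => -[[k P] Q] _; rewrite /block_of /= lhs_signed rhs_signed.
apply: NNPP; rewrite -e => np.
have [|T [V [w]]] := countermodel _ np; last by rewrite e; apply: valid.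
apply/allP => _ /mapP[[[k P] Q] /(allP oU) /and3P[aP aQ ne] ->].
rewrite /world_ok /= -empty_world lhs_signed rhs_signed ne andbT.
by rewrite /signed all_cat !all_map; apply/andP; split.
Qed.

(** * Admissibility of the cut rules *)

Lemma middle_okD (U U' : middle) : middle_ok U -> middle_ok U' -> middle_ok (U `+` U').
Proof.
move=> /allP oU /allP oU'; apply/allP => b.
by rewrite -[b \in enum_mset _]/(b \in _ `+` _) in_msetD => /orP[/oU | /oU'].
Qed.

Lemma add_block_ok k (P Q : {mset form}) (s : sequent) :
  middle_ok s.1.2 -> middle_ok (add_block k P Q s).1.2.
Proof.
case: s => [[G U] D] /= oU; case: ifP => // ne; case: ifP => [/andP[aP aQ] | _].
  apply: middle_okD oU; apply/allP => b /mset1P->.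
  by rewrite /block_ok aP aQ ne.
by case: k.
Qed.

Theorem theorem5p1 : admissible Cut /\ admissible CutSemi.
Proof.
split=> _ _ [].
- move=> D G G' De De' U U' oU oU' prem.
  have s1 T V := @soundness T V _ (prem _ (mem_head _ _)).
  have s2 T V := @soundness T V _ (prem _ (mem_last _ _)).
  apply: completeness; first exact: middle_okD.
  move=> T V w [[/all_trueD[hG hG'] /all_falseD[hD hD']] hU].
  (* The truth value of the cut formula at [w] decides which premise is refuted there. *)
  have [hA|hA] := classic (holds V w D).
    apply: (s2 _ V w); split; last by move=> b hb; apply: hU; rewrite in_msetD hb orbT.
    by rewrite /realised all_trueD all_true1.
  apply: (s1 _ V w); split; last by move=> b hb; apply: hU; rewrite in_msetD hb.
  by rewrite /realised all_falseD all_false1.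
- move=> D M M' N N' G G' De De' P Q P' Q' U U' k k' l l'.
  move=> _ mM mM' mN mN' _ _ _ _ oU oU' prem.
  have s1 T V := @soundness T V _ (prem _ (mem_head _ _)).
  have s2 T V := @soundness T V _ (prem _ (mem_last _ _)).
  set S := add_block _ _ _ _.
  have oS : middle_ok S.1.2 by do 2!apply: add_block_ok; apply: middle_okD.
  have valid (T : Type) (V : T -> nat -> Prop) w : ~ refutes V w S.
    move=> h; have [h' [x [hG hD]]] := refutes_add_block_inv h.
    have [[[hl hr] hU] [x' [hG' hD']]] := refutes_add_block_inv h'.
    move: hl hr; rewrite !(all_trueD, all_falseD).
    move=> [[[hM hM'] hP] hP'] [[[hQ hQ'] hN] hN'].
    (* The outer atoms of the conclusion make [w] realise the cut block of one premise, chosen by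
       the value of [D]; that premise is refuted at [x'] or [x], where its outer formulas are
       refuted. *)
    have [hA|hA] := classic (holds V w D).
      apply: (s2 _ V x'); apply/refutes_cons; do !split.
      + by apply/all_trueD; split=> //; apply: all_true_modal hM'.
      + by apply/all_falseD; split=> //; apply: all_false_modal hN'.
      + by move=> b hb; apply: hU; rewrite in_msetD hb orbT.
      + by exists w; split=> //=; rewrite all_trueD all_true1.
    apply: (s1 _ V x); apply/refutes_cons; do !split.
    + by apply/all_trueD; split=> //; apply: all_true_modal hM.
    + by apply/all_falseD; split=> //; apply: all_false_modal hN.
    + by move=> b hb; apply: hU; rewrite in_msetD hb.
    + by exists w; split=> //=; rewrite all_falseD all_false1.
  exact: completeness oS valid.
Qed.
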